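(* For all $n\ge0$, $I_{n,1}=\sum_{i=0}^{n}C_iF_{n-i}$, i.e. $I_{n,1}$ is the $n$-th term of the convolution of the Catalan numbers with the Fine numbers.
   Context: $I_{n,1}$ is the number of ascending (weakly increasing) $1$-Naples parking functions of length $n$ (with $I_{0,1}=1$). Parking rules: $n$ spots $1,\dots,n$; cars $c_1,\dots,c_n$ arrive in order with preferences $a_j\in[n]$; $1$-Naples rule: $c_j$ parks at $a_j$ if empty, otherwise parks at $a_j-1$ if that spot exists and is empty, otherwise drives forward from $a_j$ and parks in the first empty spot after $a_j$ (failing if none); a $1$-Naples parking function is a preference for which all cars park. $C_m=\frac1{m+1}\binom{2m}{m}$ are the Catalan numbers with generating function $C(x)$, and the Fine numbers $F_m$ are defined by $\sum_{m\ge0}F_mx^m=\frac{1}{1-x^2C(x)^2}$ (OEIS A000957). *)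

(* Defs.v *)
From mathcomp Require Import all_boot all_order all_algebra.
Set Implicit Arguments.
Unset Strict Implicit.
Unset Printing Implicit Defensive.
Import GRing.Theory.

(* Spots are the naturals 1, ..., n; [occ] lists the occupied ones. *)
Definition naples1_spot (n : nat) (occ : seq nat) (a : nat) : option nat :=
  if a \notin occ then Some a
  else if (1 < a) && (a.-1 \notin occ) then Some a.-1
  else ohead [seq s <- iota a.+1 (n - a) | s \notin occ].

Fixpoint all_cars_park (n : nat) (occ prefs : seq nat) : bool :=
  if prefs is a :: prefs' then
    if naples1_spot n occ a is Some s then all_cars_park n (s :: occ) prefs'
    else false
  else true.

(* The ordinal i : 'I_n stands for the spot i.+1. *)
Definition preferences (n : nat) (t : n.-tuple 'I_n) : seq nat :=
  [seq i.+1 | i : 'I_n <- t].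

Definition naples1_parking_function (n : nat) (t : n.-tuple 'I_n) : bool :=
  all_cars_park n [::] (preferences t).

Definition ascending (n : nat) (t : n.-tuple 'I_n) : bool :=
  sorted leq (preferences t).

Definition num_ascending_naples1 (n : nat) : nat :=
  #|[set t : n.-tuple 'I_n | ascending t && naples1_parking_function t]|.

Local Open Scope ring_scope.

(* A formal power series is represented by its sequence of coefficients. *)
Section FormalPowerSeries.
Variable K : fieldType.

Definition fps := nat -> K.

Definition fps_one : fps := fun m => (m == 0%N)%:R.

Definition fps_X : fps := fun m => (m == 1%N)%:R.

Definition fps_sub (f g : fps) : fps := fun m => f m - g m.

Definition fps_mul (f g : fps) : fps :=
  fun m => \sum_(i < m.+1) f i * g (m - i)%N.

Lemma fps_mul0 f g : fps_mul f g 0%N = f 0%N * g 0%N.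
Proof. by rewrite /fps_mul big_ord1. Qed.

(* [fps_inv_coefs f m] lists the coefficients of 1/f of degree m-1, ..., 0. *)
Fixpoint fps_inv_coefs (f : fps) (m : nat) : seq K :=
  if m is m'.+1 then
    let s := fps_inv_coefs f m' in
    (f 0%N)^-1 * ((m' == 0%N)%:R - \sum_(i < m') f i.+1 * s`_i) :: s
  else [::].

(* Meaningful when f 0 != 0; see [fps_mulV] and [fps_inv_unique]. *)
Definition fps_inv (f : fps) : fps := fun m => (fps_inv_coefs f m.+1)`_0.

Lemma nth_fps_inv_coefs f m i :
  (i < m)%N -> (fps_inv_coefs f m)`_i = fps_inv f (m - i.+1)%N.
Proof.
elim: m i => [//|m IH] [_|i lt_im]; first by rewrite subSS subn0.
by rewrite subSS -IH.
Qed.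

Lemma fps_mulV f : f 0%N != 0 -> fps_mul f (fps_inv f) =1 fps_one.
Proof.
move=> f0 m; rewrite /fps_mul big_ord_recl subn0 {1}/fps_inv /= mulrA divff //.
rewrite mul1r; set S1 := \sum_(i < m) _; set S2 := \sum_(i < m) _.
suff -> : S1 = S2 by rewrite subrK.
by apply: eq_bigr => i _; rewrite nth_fps_inv_coefs.
Qed.

Lemma fps_inv_unique f g :
  f 0%N != 0 -> fps_mul f g =1 fps_one -> g =1 fps_inv f.
Proof.
move=> f0 fg m; elim/ltn_ind: m => m IH.
apply: (mulfI f0); move: (fg m); rewrite -(fps_mulV f0 m) /fps_mul.
rewrite !big_ord_recl !subn0.
under eq_bigr => i _ do
  rewrite IH ?lift0 ?ltn_subrL ?(leq_ltn_trans (leq0n i) (ltn_ord i)) //.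
by move/addIr.
Qed.

End FormalPowerSeries.

Definition catalan (m : nat) : rat := (m.+1%:R)^-1 * 'C(m.*2, m)%:R.

Definition fine_den : fps rat :=
  fps_sub (fps_one rat)
    (fps_mul (fps_mul (fps_X rat) (fps_X rat)) (fps_mul catalan catalan)).

(* The coefficients of 1 / (1 - x^2 C(x)^2). *)
Definition fine : nat -> rat := fps_inv fine_den.

Lemma fine_den0 : fine_den 0%N = 1.
Proof. by rewrite /fine_den /fps_sub !fps_mul0 !mul0r subr0. Qed.

Lemma fineE : fps_mul fine_den fine =1 fps_one rat.
Proof. by apply: fps_mulV; rewrite fine_den0 oner_neq0. Qed.

(* Main.v *)
(* With weakly increasing preferences a spot skipped by more than one step is
   never filled.  Hence, when spots 1, ..., k are full, the next preference is
   either at most k+1 (and spot k+1 gets filled) or equal to k+2 for the next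
   two cars (a detour filling k+2, then k+1).  If a is the last preference, the
   number of completions with r cars left depends only on r and on the slack
   d = k+1-a; let W_d(x) be its generating function and D_d(x) the one without
   detours, a ballot series.  After a detour the slack is 1, so
   W_d = D_d (1 + x^2 W_1).  Since D_0 = C and D_1 = C^2, the case d = 1 says
   1 + x^2 W_1 = 1 / (1 - x^2 C^2), the Fine series, and d = 0 is the claim. *)
Require Import Defs.
From mathcomp Require Import all_boot all_order all_algebra.
From mathcomp Require Import zify.
Import GRing.Theory.

(** * Ballot numbers and the detour factor *)

(* Coefficient of x^r in D_d; in [naples_ballot], of W_d. *)
Fixpoint ballot (r d : nat) : nat :=
  if r is r'.+1 then \sum_(1 <= j < d.+2) ballot r' j else 1.

Fixpoint naples_ballot (r d : nat) : nat :=
  if r is r'.+1 then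
    \sum_(1 <= j < d.+2) naples_ballot r' j
    + (if r' is r''.+1 then naples_ballot r'' 1 else 0)
  else 1.

(* The coefficients of 1 + x^2 W_1. *)
Definition detours (m : nat) : nat :=
  match m with 0 => 1 | 1 => 0 | m'.+2 => naples_ballot m' 1 end.

Lemma naples_ballotS r d :
  naples_ballot r.+1 d
  = \sum_(1 <= j < d.+2) naples_ballot r j + detours r.+1.
Proof. by case: r. Qed.

Lemma ballotS0 r : ballot r.+1 0 = ballot r 1.
Proof. by rewrite /= big_nat1. Qed.

Lemma ballotSS r d : ballot r.+1 d.+1 = ballot r.+1 d + ballot r d.+2.
Proof. by rewrite /= big_nat_recr. Qed.

(** Reflection formula for ballot numbers, written additively to avoid truncated subtraction; it
    follows from Pascal's rule along [ballotSS]. *)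
Lemma ballot_binomial r d :
  ballot r.+1 d + 'C(r.+1.*2 + d, r) = 'C(r.+1.*2 + d, r.+1).
Proof.
elim: r d => [|r IHr] d.
  by rewrite /= sum_nat_const_nat bin0 bin1; lia.
elim: d => [|d IHd].
  rewrite ballotS0 addn0; have := IHr 1.
  have -> : r.+1.*2 + 1 = r.*2.+3 by lia.
  have -> : r.+2.*2 = r.*2.+4 by lia.
  rewrite !(binS r.*2.+3).
  have -> : 'C(r.*2.+3, r.+2) = 'C(r.*2.+3, r.+1).
    by rewrite -bin_sub; [congr 'C(_, _); lia | lia].
  by lia.
rewrite ballotSS; move: IHd (IHr d.+2).
have -> : r.+1.*2 + d.+2 = r.+2.*2 + d by lia.
by rewrite addnS !(binS (_ + d)); lia.
Qed.

Lemma ballot_central r : r.+1 * ballot r 0 = 'C(r.*2, r).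
Proof.
case: r => [|r]; first by [].
have := ballot_binomial r 0; rewrite addn0.
(* Gives (r+1) C(2r+2, r+1) = (r+2) C(2r+2, r), which eliminates the subtracted binomial. *)
have := mul_bin_left r.+1.*2 r.
have -> : r.+1.*2 - r = r.+2 by lia.
by nia.
Qed.

(** D_d C = D_(d+1): in D_d = 1 + x (D_1 + ... + D_(d+1)), multiplying by C shifts every index, and
    C = 1 + x D_1 supplies the missing first term. *)
Lemma ballot_convolution r d :
  \sum_(i < r.+1) ballot i d * ballot (r - i) 0 = ballot r d.+1.
Proof.
elim: r d => [|r IHr] d; first by rewrite big_ord1.
rewrite big_ord_recl subn0 mul1n ballotS0.
under eq_bigr => i _ do rewrite lift0 subSS /= big_distrl /=.
rewrite exchange_big /=.
under eq_bigr => j _ do rewrite IHr.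
by rewrite [in RHS]big_nat_recl //= [in RHS]big_add1.
Qed.

(** W_d = D_d (1 + x^2 W_1), since both sides satisfy the same recursion in [r] with source term
    [detours]. *)
Lemma naples_ballot_convolution r d :
  naples_ballot r d = \sum_(i < r.+1) ballot i d * detours (r - i).
Proof.
elim: r d => [|r IHr] d; first by rewrite big_ord1.
rewrite big_ord_recl subn0 mul1n naples_ballotS addnC; congr (_ + _).
under [RHS]eq_bigr => i _ do rewrite lift0 subSS /= big_distrl /=.
rewrite exchange_big /=.
by apply: eq_bigr => j _; rewrite IHr.
Qed.

(** * Counting preference lists car by car *)

Definition count_prefs (n r : nat) (P : pred (seq nat)) : nat :=
  #|[set t : r.-tuple 'I_n | P [seq i.+1 | i : 'I_n <- t]]|.

Lemma eq_count_prefs n r (P Q : pred (seq nat)) :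
  (forall s, size s = r -> all (fun a => 0 < a <= n) s -> P s = Q s) ->
  count_prefs n r P = count_prefs n r Q.
Proof.
move=> PQ; congr #|pred_of_set _|; apply/setP => t; rewrite !inE; apply: PQ.
  by rewrite size_map size_tuple.
by rewrite all_map; apply/allP => i _ /=.
Qed.

Lemma count_prefs_pred0 n r : count_prefs n r pred0 = 0.
Proof. by apply/eqP; rewrite cards_eq0; apply/eqP/setP => t; rewrite !inE. Qed.

Lemma count_prefs0 n P : count_prefs n 0 P = P [::].
Proof.
rewrite /count_prefs -sum1_card (eq_bigl (fun=> P [::])); last first.
  by move=> t; rewrite inE tuple0.
by case: (P [::]); rewrite ?big_pred0_eq // sum1_card card_tuple.
Qed.

Lemma count_prefsS n r P :
  count_prefs n r.+1 P =
  \sum_(1 <= b < n.+1) count_prefs n r (fun s => P (b :: s)).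
Proof.
rewrite big_add1 big_mkord /count_prefs -sum1_card.
under [RHS]eq_bigr => i _ do rewrite -sum1_card.
rewrite pair_big_dep /=.
rewrite (reindex (fun p : 'I_n * r.-tuple 'I_n => [tuple of p.1 :: p.2])) /=.
  by apply: eq_bigl => -[i t]; rewrite !inE.
exists (fun t => (thead t, [tuple of behead t])) => [[i t]|t] _ /=.
  by congr pair; apply: val_inj.
by rewrite [RHS]tuple_eta.
Qed.

(** * Spots that can no longer be filled *)

Lemma naples1_spot_range n occ a s :
  0 < a <= n -> naples1_spot n occ a = Some s ->
  [/\ s \notin occ, 0 < s <= n & a.-1 <= s].
Proof.
move=> an; rewrite /naples1_spot; case: ifP => [aocc [<-]|_].
  by split=> //; lia.
case: ifP => [/andP[a1 aocc] [<-]|_]; first by split=> //; lia.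
case E: (filter _ _) => [|x l] //= [<-].
have: x \in [seq s <- iota a.+1 (n - a) | s \notin occ] by rewrite E mem_head.
by rewrite mem_filter mem_iota => /andP[xocc xr]; split=> //; lia.
Qed.

(* Preferences beyond h+1 never fill h, even by backing up one spot. *)
Lemma permanent_hole n h (occ s : seq nat) :
  0 < h <= n -> h \notin occ -> uniq occ -> all (fun a => 0 < a <= n) occ ->
  all (fun a => 0 < a <= n) s -> all (fun a => h.+2 <= a) s ->
  all_cars_park n occ s -> size occ + size s < n.
Proof.
move=> hn; elim: s occ => [|b s IHs] occ hocc occU occn /=.
  move=> _ _ _; rewrite addn0.
  (* Pigeonhole: [h] and the occupied spots are distinct elements of 1, ..., n. *)
  have /uniq_leq_size : uniq (h :: occ) by rewrite /= hocc.
  move=> /(_ (iota 1 n)); rewrite size_iota; apply=> x.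
  rewrite inE mem_iota => /orP[/eqP->|/(allP occn)]; lia.
move=> /andP[bn sn] /andP[hb hs]; case E: naples1_spot => [c|] // parks.
have [cocc cn bc] := naples1_spot_range _ _ _ _ bn E.
rewrite addnS -addSn; apply: (IHs (c :: occ)) => //=.
- by rewrite inE negb_or hocc andbT; lia.
- by rewrite cocc.
- by rewrite cn.
Qed.

Definition completions (n : nat) (occ : seq nat) (a r : nat) : nat :=
  count_prefs n r (fun s => path leq a s && all_cars_park n occ s).

Lemma completions_cons n occ a b c r :
  a <= b -> naples1_spot n occ b = Some c ->
  count_prefs n r
    (fun s => path leq a (b :: s) && all_cars_park n occ (b :: s))
  = completions n (c :: occ) b r.
Proof. by move=> ab E; apply: eq_count_prefs => s _ _ /=; rewrite ab E. Qed.

(** All later preferences are at least [b], so [h] stays empty, although the remaining cars would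
    need every free spot. *)
Lemma completions_doomed n (occ : seq nat) a b h r :
  0 < h <= n -> h \notin occ -> uniq occ -> all (fun a => 0 < a <= n) occ ->
  h.+2 <= b <= n -> n <= size occ + r.+1 ->
  count_prefs n r
    (fun s => path leq a (b :: s) && all_cars_park n occ (b :: s)) = 0.
Proof.
move=> hn hocc occU occn hb nr; rewrite -(count_prefs_pred0 n r).
apply: eq_count_prefs => s ss sn; apply/negP => /andP[/= /andP[ab bs] parks].
suff : size occ + size (b :: s) < n by rewrite /= ss; lia.
apply: (@permanent_hole n h) => //=; first by rewrite sn andbT; lia.
apply/andP; split; first by lia.
move: bs; rewrite (path_sortedE leq_trans) => /andP[/allP bs _].
by apply/allP => x /bs; lia.
Qed.

Lemma completions_below n occ a b r :
  b < a ->
  count_prefs n r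
    (fun s => path leq a (b :: s) && all_cars_park n occ (b :: s)) = 0.
Proof.
move=> ba; rewrite -(count_prefs_pred0 n r).
by apply: eq_count_prefs => s _ _ /=; rewrite leqNgt ba.
Qed.

(** * Completions when an initial segment is full *)

Lemma perm_cons_iota (occ : seq nat) k :
  perm_eq occ (iota 1 k) -> perm_eq (k.+1 :: occ) (iota 1 k.+1).
Proof.
move=> occP; rewrite -(addn1 k) iotaD /= [k + 1]addnC cats1 perm_sym.
by rewrite perm_rcons perm_cons perm_sym.
Qed.

Lemma naples1_spot_full n (occ : seq nat) k b :
  perm_eq occ (iota 1 k) -> 0 < b <= k.+1 -> k < n ->
  naples1_spot n occ b = Some k.+1.
Proof.
move=> /perm_mem occE bk kn; rewrite /naples1_spot !occE !mem_iota.
case: ifP => [?|bocc]; first by congr Some; lia.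
case: ifP => [?|_]; first by lia.
(* The forward search passes the full spots up to [k] and stops at [k.+1]. *)
have -> : n - b = (k - b) + (n - k.+1).+1 by lia.
rewrite iotaD filter_cat (_ : filter _ _ = [::]); last first.
  rewrite (@eq_in_filter _ _ pred0) ?filter_pred0 // => x.
  by rewrite occE !mem_iota /= => xb; apply/negbTE; rewrite negbK; lia.
have -> : b.+1 + (k - b) = k.+1 by lia.
by rewrite /= occE mem_iota ifT //; lia.
Qed.

(** The next car must prefer [k.+2] again: less breaks the order, more loses [k.+1] for good. It
    backs up into [k.+1], and the slack becomes (k+3) - (k+2) = 1. *)
Lemma completions_hole n (occ : seq nat) k r :
  perm_eq occ (iota 1 k) -> k + r.+2 = n ->
  (forall occ', perm_eq occ' (iota 1 k.+2) ->
     completions n occ' k.+2 r = naples_ballot r 1) ->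
  completions n (k.+2 :: occ) k.+2 r.+1 = naples_ballot r 1.
Proof.
move=> occP nE IH; rewrite /completions count_prefsS.
have occE x : (x \in occ) = (0 < x <= k).
  by rewrite (perm_mem occP) mem_iota; lia.
have occU : uniq occ by rewrite (perm_uniq occP) iota_uniq.
have occS : size occ = k by rewrite (perm_size occP) size_iota.
rewrite (bigD1_seq k.+2) ?mem_index_iota ?iota_uniq //; last lia.
rewrite big_nat_cond big1 ?addn0 => [|b /andP[bn bk]]; last first.
  have [bk'|bk'] := ltnP b k.+2; first exact: completions_below.
  apply: (@completions_doomed _ _ _ _ k.+1) => /=.
  - lia.
  - by rewrite inE occE; lia.
  - by rewrite occE occU; lia.
  - by apply/andP; split; [lia | apply/allP => x; rewrite occE; lia].
  - lia.
  - by rewrite occS; lia.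
rewrite (@completions_cons _ _ _ _ k.+1) //.
  rewrite /= addn0; apply: IH; rewrite (perm_catCA [:: k.+1] [:: k.+2]).
  exact/perm_cons_iota/perm_cons_iota.
rewrite /naples1_spot inE eqxx /= inE occE ifT //; lia.
Qed.

(** Case split on the next preference; the induction is strong because a detour uses two cars. *)
Lemma completions_full n (occ : seq nat) k a d r :
  perm_eq occ (iota 1 k) -> 0 < a -> a + d = k.+1 -> k + r = n ->
  completions n occ a r = naples_ballot r d.
Proof.
elim/ltn_ind: r occ k a d => -[|r] IH occ k a d occP a0 ad nE.
  by rewrite /completions count_prefs0.
have occE x : (x \in occ) = (0 < x <= k).
  by rewrite (perm_mem occP) mem_iota; lia.
have occU : uniq occ by rewrite (perm_uniq occP) iota_uniq.
have occS : size occ = k by rewrite (perm_size occP) size_iota.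
rewrite /completions count_prefsS (big_cat_nat (n := a)); [|lia|lia].
rewrite big_nat big1 => [|b bn]; last by apply: completions_below; lia.
rewrite -[LHS]/(_ + _) add0n.
(* A preference b from [a] to [k.+1] fills [k.+1] and leaves slack k+2-b, which runs over 1, ...,
   d+1. *)
rewrite (big_cat_nat (n := k.+2)); [|lia|lia].
rewrite naples_ballotS; apply: (congr2 addn).
  rewrite (@eq_big_nat _ _ _ _ _ _ (fun b => naples_ballot r (k.+2 - b))).
    rewrite [RHS]big_nat_rev [RHS]big_add1 -{1}[a]add0n big_addn.
    have -> : k.+2 - a = d.+1 by lia.
    by apply: eq_bigr => i _; congr naples_ballot; lia.
  move=> b bn; rewrite (@completions_cons _ _ _ _ k.+1); first last.
  - by apply: naples1_spot_full => //; lia.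
  - lia.
  apply: (IH _ _ _ k.+1); try lia.
  exact: perm_cons_iota.
(* With one car left, k+1 = n and no spot [k.+2] exists. *)
case: r nE IH => [|r] nE IH; first by rewrite big_geq //; lia.
(* Preference [k.+2] starts a detour; any larger one dooms [k.+1]. *)
rewrite big_ltn; last lia.
rewrite big_nat big1 => [|b bn]; last first.
  apply: (@completions_doomed _ _ _ _ k.+1) => //.
  - lia.
  - by rewrite occE; lia.
  - by apply/allP => x; rewrite occE; lia.
  - lia.
rewrite -[LHS]/(_ + _) addn0.
rewrite (@completions_cons _ _ _ _ k.+2); [|lia|]; last first.
  by rewrite /naples1_spot occE ifT //; lia.
apply: completions_hole => // occ' occP'.
by apply: (IH _ _ _ k.+2) => //; lia.
Qed.

Lemma num_ascending_naples1E n : num_ascending_naples1 n = naples_ballot n 0.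
Proof.
(* A fictitious previous preference 1 imposes no constraint; with no spot full, the slack is 0. *)
rewrite -(@completions_full n [::] 0 1 0 n) //.
apply: (@eq_count_prefs n n (fun s => sorted leq s && all_cars_park n [::] s)).
by case=> [|b s] //= _ /andP[/andP[-> _] _].
Qed.

(** * Catalan and Fine series *)

Local Open Scope ring_scope.

Lemma catalanE r : catalan r = (ballot r 0)%:R.
Proof.
rewrite /catalan -ballot_central natrM mulrA mulVf ?mul1r //.
by rewrite Num.Theory.pnatr_eq0.
Qed.

Lemma fps_mulX_X (K : fieldType) m :
  fps_mul (fps_X K) (fps_X K) m = (m == 2%N)%:R.
Proof.
rewrite /fps_mul /fps_X; case: m => [|m]; first by rewrite big_ord1 mul0r.
rewrite !big_ord_recl /= mul0r add0r mul1r big1 ?addr0 => [|i _]; last first.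
  by rewrite mul0r.
by rewrite subSS subn0.
Qed.

Lemma fps_mulXX (K : fieldType) (f : fps K) m :
  fps_mul (fps_mul (fps_X K) (fps_X K)) f m.+2 = f m.
Proof.
rewrite {1}/fps_mul !big_ord_recl /= !fps_mulX_X !mul0r !add0r mul1r.
rewrite big1 ?addr0 => [|i _]; last by rewrite fps_mulX_X mul0r.
by rewrite !subSS subn0.
Qed.

Lemma fine_den1 : fine_den 1%N = 0.
Proof.
rewrite /fine_den /fps_sub /fps_mul !big_ord_recl !big_ord0 /fps_X /=.
by rewrite !(mul0r, mulr0, addr0, subr0).
Qed.

Lemma fine_denSS m : fine_den m.+2 = - (ballot m 1)%:R.
Proof.
rewrite /fine_den /fps_sub fps_mulXX sub0r -ballot_convolution natr_sum.
by congr (- _); apply: eq_bigr => i _; rewrite !catalanE natrM.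
Qed.

(** By uniqueness of inverses it suffices that (1 - x^2 D_1)(1 + x^2 W_1) = 1, which is W_1 = D_1 (1
    + x^2 W_1). *)
Lemma fine_detours m : fine m = (detours m)%:R.
Proof.
symmetry; move: m.
apply: (@fps_inv_unique _ fine_den (fun m => (detours m)%:R)).
  by rewrite fine_den0 oner_neq0.
move=> [|[|m]]; rewrite /fps_mul.
- by rewrite big_ord1 fine_den0 mul1r.
- by rewrite !big_ord_recl big_ord0 /= fine_den1 mulr0 mul0r !addr0.
rewrite 2!big_ord_recl /= fine_den0 fine_den1 mul1r mul0r add0r /=.
rewrite naples_ballot_convolution natr_sum -big_split big1 // => i _.
by rewrite fine_denSS !subSS natrM mulNr; apply: addrN.
Qed.

Theorem theorem5p5 (n : nat) :
  (num_ascending_naples1 n)%:R =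
    \sum_(0 <= i < n.+1) catalan i * fine (n - i)%N :> rat.
Proof.
rewrite num_ascending_naples1E naples_ballot_convolution natr_sum big_mkord.
by apply: eq_bigr => i _; rewrite natrM catalanE fine_detours.
Qed.
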